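(* Let $\Lambda$ be a row-finite $\mathbb{N}$-graph with no sources. Then $C^{*}(\Lambda) = \overline{\bigcup_{k\in \mathbb{N}} C^{*}({}^k\Lambda)}$; that is, $C^*(\Lambda)$ is canonically isomorphic to the inductive limit of the directed system of $k$-graph $C^*$-algebras $\{C^*({}^k\Lambda)\}_{k}$ with the canonical inclusions $C^*({}^i\Lambda)\to C^*({}^k\Lambda)$, $s_\lambda\mapsto s_\lambda$ ($i\le k$, $\lambda\in{}^i\Lambda$), as connecting maps, where the isomorphism carries the image of the generator $s_\lambda\in C^*({}^k\Lambda)$ to $s_\lambda\in C^*(\Lambda)$.
   Context: $\mathbb{N}^{\mathbb{N}}_{0}$ is the monoid of sequences $(n_1,n_2,\dots)$ of nonnegative integers with only finitely many nonzero entries, with entrywise addition. An $\mathbb{N}$-graph $(\Lambda,d)$ is a countable small category $\Lambda$ with range and source maps $r,s$ ($\lambda\mu$ is defined when $s(\lambda)=r(\mu)$) and a functor $d:\Lambda\to\mathbb{N}^{\mathbb{N}}_{0}$ with the factorization property: whenever $d(\lambda)=m+n$ there are unique $\mu,\nu\in\Lambda$ with $\lambda=\mu\nu$, $d(\mu)=m$, $d(\nu)=n$. Put $\Lambda^n=d^{-1}(n)$; $\Lambda^0$ is identified with the set of objects (vertices). For $v\in\Lambda^0$, $v\Lambda^n=\{\lambda\in\Lambda^n: r(\lambda)=v\}$. $\Lambda$ is row-finite if every $v\Lambda^n$ is finite, and has no sources if every $v\Lambda^n$ is nonempty. A $k$-graph is defined in the same way with $\mathbb{N}^k$ in place of $\mathbb{N}^{\mathbb{N}}_{0}$.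 For $k\ge 1$, ${}^k\Lambda=\{\lambda\in\Lambda: \text{the } n\text{-th entry of } d(\lambda)\text{ is }0\text{ for all }n>k\}$, a $k$-graph with degree functor given by the first $k$ entries of $d$ and with the restricted range and source maps. For a row-finite $\mathbb{N}$-graph (respectively $k$-graph) $\Gamma$ with no sources, a Cuntz–Krieger $\Gamma$-family is a family of partial isometries $\{s_\lambda:\lambda\in\Gamma\}$ in a $C^*$-algebra such that (CK1) $\{s_v:v\in\Gamma^0\}$ are mutually orthogonal projections; (CK2) $s_{\lambda}s_\mu=s_{\lambda\mu}$ if $s(\lambda)=r(\mu)$ and $s_\lambda s_\mu=0$ otherwise; (CK3) $s_\lambda^*s_\lambda=s_{s(\lambda)}$; (CK4) $s_v=\sum_{\lambda\in v\Gamma^n}s_\lambda s_\lambda^*$ for all $v\in\Gamma^0$ and all degrees $n$. $C^*(\Gamma)$ is the universal $C^*$-algebra generated by a Cuntz–Krieger $\Gamma$-family $\{s_\lambda\}$. The canonical inclusions are injective *-homomorphisms, and $\overline{\bigcup_k C^*({}^k\Lambda)}$ denotes the resulting inductive limit. *)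

(* Defs.v *)
From HB Require Import structures.
From mathcomp Require Import all_boot all_order all_algebra.
From mathcomp Require Import finmap.
From mathcomp Require Import all_classical all_reals all_analysis.
From mathcomp.real_closed Require Import complex.

Set Implicit Arguments.
Unset Strict Implicit.
Unset Printing Implicit Defensive.

Import Order.TTheory GRing.Theory Num.Theory.
Import numFieldNormedType.Exports.

Local Open Scope classical_set_scope.
Local Open Scope ring_scope.
Local Open Scope complex_scope.

(** * C*-algebras *)

(* MathComp rings are unital, whereas C*-algebras of graphs with infinitely
   many vertices are not: the product is an explicit operation.  The norm of a
   normed module over [R[i]] takes its values in [R[i]], where they are real. *)
HB.mixin Record isCStarAlgebra (R : realType) A
    of CompleteNormedModule R[i] A := {
  cmul : A -> A -> A;
  star : A -> A;
  cmulA : forall x y z : A, cmul x (cmul y z) = cmul (cmul x y) z;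
  cmul_linl : forall (a : R[i]) (x y z : A),
    cmul (a *: x + y) z = a *: cmul x z + cmul y z;
  cmul_linr : forall (a : R[i]) (x y z : A),
    cmul z (a *: x + y) = a *: cmul z x + cmul z y;
  star_conj_lin : forall (a : R[i]) (x y : A),
    star (a *: x + y) = (a^*)%C *: star x + star y;
  starM : forall x y : A, star (cmul x y) = cmul (star y) (star x);
  starK : forall x : A, star (star x) = x;
  normr_cmul : forall x y : A, `|cmul x y| <= `|x| * `|y|;
  cstar_identity : forall x : A, `|cmul (star x) x| = `|x| ^+ 2
}.

#[short(type="cstarAlgType")]
HB.structure Definition CStarAlgebra (R : realType) :=
  {A of CompleteNormedModule R[i] A & isCStarAlgebra R A}.

Notation "x ** y" := (cmul x y) (at level 40, left associativity) : ring_scope.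

Section StarHom.
Variable R : realType.

Record star_hom (A B : cstarAlgType R) (f : A -> B) : Prop := {
  star_hom_linear : forall (a : R[i]) (x y : A),
    f (a *: x + y) = a *: f x + f y;
  star_homM : forall x y : A, f (x ** y) = f x ** f y;
  star_hom_star : forall x : A, f (star x) = star (f x)
}.

Record closed_star_subalgebra (A : cstarAlgType R) (S : set A) : Prop := {
  csub_closed : closed S;
  csub0 : S 0;
  csub_lin : forall (a : R[i]) (x y : A), S x -> S y -> S (a *: x + y);
  csubM : forall x y : A, S x -> S y -> S (x ** y);
  csub_star : forall x : A, S x -> S (star x)
}.

Definition generated_by (A : cstarAlgType R) (G : set A) : Prop :=
  forall S : set A, closed_star_subalgebra S -> G `<=` S -> S = setT.

(* Inductive limits in the category of C*-algebras and *-homomorphisms. *)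
Section InductiveLimit.
Variables (A : nat -> cstarAlgType R)
  (iota : forall i j : nat, (i <= j)%N -> A i -> A j).

Record inductive_system : Prop := {
  indsys_hom : forall i j (h : (i <= j)%N), star_hom (iota h);
  indsys_id : forall i (h : (i <= i)%N) (a : A i), iota h a = a;
  indsys_comp : forall i j k (hij : (i <= j)%N) (hjk : (j <= k)%N)
    (hik : (i <= k)%N) (a : A i), iota hjk (iota hij a) = iota hik a
}.

Record cocone (L : cstarAlgType R) (psi : forall k, A k -> L) : Prop := {
  cocone_hom : forall k, star_hom (psi k);
  cocone_comp : forall i j (h : (i <= j)%N) (a : A i),
    psi j (iota h a) = psi i a
}.

Record is_inductive_limit (L : cstarAlgType R) (psi : forall k, A k -> L) :
    Prop := {
  indlim_system : inductive_system;
  indlim_cocone : cocone psi;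
  indlim_universal : forall (B : cstarAlgType R) (theta : forall k, A k -> B),
    cocone theta ->
    exists! f : L -> B,
      star_hom f /\ forall k (a : A k), f (psi k a) = theta k a
}.

End InductiveLimit.
End StarHom.

(** * Higher-rank graphs *)

(* The monoid of finitely supported sequences; the paper's n-th entry is the
   value at index n - 1. *)
Definition finNseq := {fsfun nat -> nat with 0%N}.
HB.instance Definition _ := Choice.on finNseq.

Definition finNseq0 : finNseq := [fsfun]%fset.
Definition finNseq_add (m n : finNseq) : finNseq :=
  [fsfun i in (finsupp m `|` finsupp n)%fset => (m i + n i)%N].

Lemma finNseq_addE (m n : finNseq) i : finNseq_add m n i = (m i + n i)%N.
Proof.
rewrite fsfunE in_fsetU; case: ifPn => // /norP[mi ni].
by rewrite (fsfun_dflt mi) (fsfun_dflt ni).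
Qed.

Lemma finNseq_addA : associative finNseq_add.
Proof. by move=> m n p; apply/fsfunP => i; rewrite !finNseq_addE addnA. Qed.
Lemma finNseq_addC : commutative finNseq_add.
Proof. by move=> m n; apply/fsfunP => i; rewrite !finNseq_addE addnC. Qed.
Lemma finNseq_add0 : left_id finNseq0 finNseq_add.
Proof. by move=> m; apply/fsfunP => i; rewrite finNseq_addE fsfun0E. Qed.

HB.instance Definition _ :=
  GRing.isNmodule.Build finNseq finNseq_addA finNseq_addC finNseq_add0.

Lemma finNseqDE (m n : finNseq) i : (m + n) i = (m i + n i)%N.
Proof. exact: finNseq_addE. Qed.

Lemma finNseq0E i : (0 : finNseq) i = 0%N.
Proof. by rewrite fsfun0E. Qed.

(* A graph with degrees in a commutative monoid [P]: [P = finNseq] gives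
   N-graphs and [P = {ffun 'I_k -> nat}] gives k-graphs.  Vertices are the
   objects; [idp] identifies them with the paths of degree 0. *)
Record pgraph (P : nmodType) := PGraph {
  vertex : countType;
  gpath : countType;
  rng : gpath -> vertex;
  src : gpath -> vertex;
  idp : vertex -> gpath;
  gcomp : forall l m : gpath, src l = rng m -> gpath;
  rng_idp : forall v, rng (idp v) = v;
  src_idp : forall v, src (idp v) = v;
  rng_comp : forall l m (e : src l = rng m), rng (gcomp e) = rng l;
  src_comp : forall l m (e : src l = rng m), src (gcomp e) = src m;
  comp_idl : forall v l (e : src (idp v) = rng l), gcomp e = l;
  comp_idr : forall l v (e : src l = rng (idp v)), gcomp e = l;
  compA : forall l m n (e : src l = rng m) (f : src m = rng n)
    (e' : src l = rng (gcomp f)) (f' : src (gcomp e) = rng n),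
    gcomp e' = gcomp f';
  deg : gpath -> P;
  deg_idp : forall v, deg (idp v) = 0;
  deg_comp : forall l m (e : src l = rng m), deg (gcomp e) = deg l + deg m;
  factorization : forall l (m n : P), deg l = m + n ->
    exists! p : gpath * gpath, exists e : src p.1 = rng p.2,
      [/\ gcomp e = l, deg p.1 = m & deg p.2 = n]
}.

Arguments idp {P} _ _.

Notation Ngraph := (pgraph finNseq).
Notation kgraph k := (pgraph {ffun 'I_k -> nat}).

(* [paths_from v n] is the set v Lambda^n (paths with range [v]). *)
Definition paths_from (P : nmodType) (G : pgraph P) (v : vertex G) (n : P) :
  set (gpath G) := [set l | rng l = v /\ deg l = n].

Definition row_finite (P : nmodType) (G : pgraph P) : Prop :=
  forall (v : vertex G) (n : P), finite_set (paths_from v n).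

Definition no_sources (P : nmodType) (G : pgraph P) : Prop :=
  forall (v : vertex G) (n : P), paths_from v n !=set0.

Section Truncation.
Variables (L : Ngraph) (k : nat).

Definition in_trunc (l : gpath L) : bool :=
  `[< forall i, (k <= i)%N -> deg l i = 0%N >].

Definition tpath := {l : gpath L | in_trunc l}.

Definition tdeg (l : tpath) : {ffun 'I_k -> nat} :=
  [ffun i : 'I_k => deg (val l) i].

Lemma in_trunc_idp v : in_trunc (idp L v).
Proof. by apply/asboolP => i _; rewrite deg_idp finNseq0E. Qed.

Lemma in_trunc_comp (l m : gpath L) (e : src l = rng m) :
  in_trunc l -> in_trunc m -> in_trunc (gcomp e).
Proof.
move=> /asboolP hl /asboolP hm; apply/asboolP => i ki.
by rewrite deg_comp finNseqDE hl ?hm.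
Qed.

Lemma in_trunc_compE (l m : gpath L) (e : src l = rng m) :
  in_trunc (gcomp e) -> in_trunc l /\ in_trunc m.
Proof.
move=> /asboolP h; split; apply/asboolP => i /h;
  by rewrite deg_comp finNseqDE => /eqP; rewrite addn_eq0 => /andP[/eqP ? /eqP].
Qed.

Definition tidp (v : vertex L) : tpath := exist _ (idp L v) (in_trunc_idp v).

Definition tcomp (l m : tpath) (e : src (val l) = rng (val m)) : tpath :=
  exist _ (gcomp e) (in_trunc_comp e (valP l) (valP m)).

Definition pad (m : {ffun 'I_k -> nat}) : finNseq :=
  [fsfun i in [fset j | j in iota 0 k]%fset => oapp m 0%N (insub i)].

Lemma padE m (i : 'I_k) : pad m i = m i.
Proof. by rewrite fsfunE !inE /= mem_iota /= add0n ltn_ord valK. Qed.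

Lemma pad_in m i (ik : (i < k)%N) : pad m i = m (Ordinal ik).
Proof. exact: (padE m (Ordinal ik)). Qed.

Lemma pad_out m i : (k <= i)%N -> pad m i = 0%N.
Proof. by move=> ki; rewrite fsfunE !inE /= mem_iota add0n ltnNge ki. Qed.

Lemma deg_padP (l : gpath L) (m : {ffun 'I_k -> nat}) (hl : in_trunc l) :
  tdeg (exist _ l hl) = m <-> deg l = pad m.
Proof.
split=> [<-|h]; last by apply/ffunP => i; rewrite ffunE /= h padE.
apply/fsfunP => i; have [ki|ik] := leqP k i.
  by rewrite pad_out //; move/asboolP: hl; apply.
by rewrite pad_in ffunE.
Qed.

Lemma tfactorization (l : tpath) (m n : {ffun 'I_k -> nat}) :
  tdeg l = m + n ->
  exists! p : tpath * tpath, exists e : src (val p.1) = rng (val p.2),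
    [/\ tcomp e = l, tdeg p.1 = m & tdeg p.2 = n].
Proof.
case: l => l hl /deg_padP dl.
have {}dl : deg l = pad m + pad n.
  rewrite dl; apply/fsfunP => i; rewrite finNseqDE; have [ki|ik] := leqP k i.
    by rewrite !pad_out.
  by rewrite !pad_in ffunE.
have [[mu nu] /= [[e [el dmu dnu]] uniq]] := factorization dl.
have [hmu hnu] : in_trunc mu /\ in_trunc nu.
  by apply: (@in_trunc_compE _ _ e); rewrite el.
exists (exist _ mu hmu, exist _ nu hnu); split=> /=.
  by exists e; split; [apply: val_inj | apply/deg_padP | apply/deg_padP].
move=> [[mu' hmu'] [nu' hnu']] /= [e' [/(congr1 val) /= el']].
move=> /deg_padP dmu' /deg_padP dnu'.
have : (mu, nu) = (mu', nu') by apply: uniq; exists e'.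
move=> [emu enu].
by congr pair; apply: val_inj.
Qed.

(* The k-graph of all paths whose degree lives on the first k coordinates. *)
Definition trunc : kgraph k.
Proof.
apply: (@PGraph {ffun 'I_k -> nat} (vertex L) tpath
  (fun l => rng (val l)) (fun l => src (val l)) tidp tcomp _ _ _ _ _ _ _
  tdeg _ _ tfactorization).
- by move=> v; exact: rng_idp.
- by move=> v; exact: src_idp.
- by move=> l m e; exact: rng_comp.
- by move=> l m e; exact: src_comp.
- by move=> v l e; apply: val_inj; exact: comp_idl.
- by move=> l v e; apply: val_inj; exact: comp_idr.
- by move=> l m n e f e' f'; apply: val_inj; exact: compA.
- by move=> v; apply/ffunP => i; rewrite !ffunE /= deg_idp finNseq0E.
- by move=> l m e; apply/ffunP => i; rewrite !ffunE /= deg_comp finNseqDE.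
Defined.

Definition trunc_incl (l : gpath trunc) : gpath L := sval l.

End Truncation.

Lemma in_trunc_le (L : Ngraph) (i k : nat) (h : (i <= k)%N) (l : gpath L) :
  in_trunc i l -> in_trunc k l.
Proof. by move=> /asboolP hl; apply/asboolP => j /(leq_trans h)/hl. Qed.

Definition trunc_widen (L : Ngraph) (i k : nat) (h : (i <= k)%N)
  (l : gpath (trunc L i)) : gpath (trunc L k) :=
  exist _ (sval l) (in_trunc_le h (svalP l)).

(** * Cuntz-Krieger families *)

Record ck_family (R : realType) (P : nmodType) (G : pgraph P)
    (A : cstarAlgType R) (s : gpath G -> A) : Prop := {
  ck_partial_isometry : forall l, s l ** star (s l) ** s l = s l;
  ck1_proj : forall v, star (s (idp G v)) = s (idp G v) /\
    s (idp G v) ** s (idp G v) = s (idp G v);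
  ck1_orth : forall v w, v <> w -> s (idp G v) ** s (idp G w) = 0;
  ck2 : forall l m (e : src l = rng m), s l ** s m = s (gcomp e);
  ck2_0 : forall l m, src l <> rng m -> s l ** s m = 0;
  ck3 : forall l, star (s l) ** s l = s (idp G (src l));
  (* [\sum_(l \in S)] over a classical set; it is the sum over [S] since [S]
     is finite when the graph is row-finite. *)
  ck4 : forall v n,
    s (idp G v) = \sum_(l \in paths_from v n) (s l ** star (s l))
}.

(* [(A, s)] is the universal C*-algebra generated by a Cuntz-Krieger family. *)
Record is_graph_cstar_algebra (R : realType) (P : nmodType) (G : pgraph P)
    (A : cstarAlgType R) (s : gpath G -> A) : Prop := {
  graph_cstar_ck : ck_family s;
  graph_cstar_generated : generated_by (range s);
  graph_cstar_universal : forall (B : cstarAlgType R) (t : gpath G -> B),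
    ck_family t ->
    exists! f : A -> B, star_hom f /\ forall l, f (s l) = t l
}.

(* Main.v *)
(* The restriction of a Cuntz-Krieger family to a truncation is again one, and
   conversely a family on the N-graph is one as soon as all its restrictions
   are.  A cocone on the algebras of the truncations therefore amounts to a
   Cuntz-Krieger family of the N-graph, so the algebra of the N-graph is itself
   an inductive limit, and inductive limits are unique up to isomorphism.
   Density of the union of the images holds because the closure of a
   *-subalgebra is a *-subalgebra and every path lies in some truncation. *)

Require Import Defs.
From mathcomp Require Import all_boot all_order all_algebra finmap.
From mathcomp Require Import all_classical all_reals all_analysis.
From mathcomp.real_closed Require Import complex.

Set Implicit Arguments.
Unset Strict Implicit.
Unset Printing Implicit Defensive.

Import Order.TTheory GRing.Theory Num.Theory.
Import numFieldNormedType.Exports.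

Local Open Scope classical_set_scope.
Local Open Scope ring_scope.

(** * Continuity and closures *)

Lemma lipschitz_normed_continuous (K : numFieldType) (V W : normedModType K)
    (c : K) (f : V -> W) :
  0 <= c -> (forall x y, `|f x - f y| <= c * `|x - y|) -> continuous f.
Proof.
move=> c0 fc x; apply/cvgrPdist_lt => e e0.
(* [c] may vanish, so the distance is bounded by [e / (c + 1)]. *)
have c1 : 0 < c + 1 by rewrite ltr_wpDl.
near=> y; apply: (le_lt_trans (fc x y)).
apply: (@le_lt_trans _ _ ((c + 1) * `|x - y|)).
  by rewrite ler_wpM2r// lerDl.
rewrite mulrC -ltr_pdivlMr//.
near: y; apply: cvgr_dist_lt; [exact: cvg_id | exact: divr_gt0].
Unshelve. all: by end_near.
Qed.

(** The preimage of [closure D] is closed and contains [S], hence contains [closure S]. *)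
Lemma closure_continuous (T U : topologicalType) (f : T -> U) (S : set T)
    (D : set U) :
  continuous f -> (forall x, S x -> closure D (f x)) ->
  forall x, closure S x -> closure D (f x).
Proof.
move=> cf SD x Sx.
have cl : closed (f @^-1` closure D).
  by apply: preimage_closed => [y _|]; [exact: cf | exact: closed_closure].
by apply: cl; exact: (closure_subset SD).
Qed.

(** * Star-homomorphisms, Cuntz-Krieger families and universal properties *)

Section StarHomTheory.
Variable R : realType.
Implicit Types A B C : cstarAlgType R.

Lemma star_hom_comp A B C (f : A -> B) (g : B -> C) :
  star_hom f -> star_hom g -> star_hom (g \o f).
Proof.
move=> [fL fM fS] [gL gM gS].
by split=> * /=; rewrite ?fL ?fM ?fS ?gL ?gM ?gS.
Qed.

Lemma star_hom0 A B (f : A -> B) : star_hom f -> f 0 = 0.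
Proof.
move=> [fL _ _]; have := fL 1 0 0.
by rewrite !scale1r addr0 -[LHS]addr0 => /addrI.
Qed.

Lemma star_homD A B (f : A -> B) : star_hom f -> {morph f : x y / x + y}.
Proof. by move=> [fL _ _] x y; have := fL 1 x y; rewrite !scale1r. Qed.

(** A sum with infinite support is 0 by convention, and [f] could kill all but finitely many terms;
    finiteness of [D] excludes this. *)
Lemma star_hom_fsum A B (f : A -> B) (T : choiceType) (D : set T) (F : T -> A) :
  star_hom f -> finite_set D ->
  f (\sum_(i \in D) F i) = \sum_(i \in D) f (F i).
Proof.
move=> hf fD; rewrite !fsbig_finite //.
exact: (big_morph f (star_homD hf) (star_hom0 hf)).
Qed.

Lemma ck_family_star_hom (P : nmodType) (G : pgraph P) A B
    (s : gpath G -> A) (f : A -> B) :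
  row_finite G -> star_hom f -> ck_family s -> ck_family (f \o s).
Proof.
move=> rG hf [spi s1 s1o s2 s20 s3 s4]; have [fL fM fS] := hf.
split=> /=.
- by move=> l; rewrite -fS -!fM spi.
- by move=> v; have [sv1 sv2] := s1 v; rewrite -fS -fM sv1 sv2.
- by move=> v w vw; rewrite -fM s1o// star_hom0.
- by move=> l m e; rewrite -fM s2.
- by move=> l m e; rewrite -fM s20// star_hom0.
- by move=> l; rewrite -fS -fM s3.
- move=> v n; rewrite (s4 v n) star_hom_fsum//.
  by apply: eq_fsbigr => l _; rewrite fM fS.
Qed.

(** Both maps factor the Cuntz-Krieger family [f \o s] through [s], so the uniqueness in the
    universal property identifies them. *)
Lemma graph_cstar_ext (P : nmodType) (G : pgraph P) A B (s : gpath G -> A)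
    (f g : A -> B) :
  row_finite G -> is_graph_cstar_algebra s -> star_hom f -> star_hom g ->
  (forall l, f (s l) = g (s l)) -> f =1 g.
Proof.
move=> rG [sck _ suniv] hf hg fg.
have [k [_ kuniq]] := suniv _ _ (ck_family_star_hom rG hf sck).
have fE : k = f by apply: kuniq.
have gE : k = g by apply: kuniq; split=> // l /=; rewrite fg.
by move=> x; rewrite -fE gE.
Qed.

(** Common form of restricting along [trunc_incl] and along [trunc_widen]. Injectivity of [hv]
    preserves orthogonality and non-composability; the condition on [paths_from] turns (CK4) at
    degree [n] into (CK4) of [H] at degree [m], reindexed along [h]. *)
Lemma ck_family_pullback (P Q : nmodType) (G : pgraph P) (H : pgraph Q)
    (hv : vertex G -> vertex H) (h : gpath G -> gpath H) A (t : gpath H -> A) :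
  injective hv -> injective h ->
  (forall l, rng (h l) = hv (rng l)) -> (forall l, src (h l) = hv (src l)) ->
  (forall v, h (idp G v) = idp H (hv v)) ->
  (forall l m (e : src l = rng m) (e' : src (h l) = rng (h m)),
    h (gcomp e) = gcomp e') ->
  (forall v n, exists m, paths_from (hv v) m = h @` paths_from v n) ->
  ck_family t -> ck_family (t \o h).
Proof.
move=> hvI hI hr hs hid hc hp [tpi t1 t1o t2 t20 t3 t4].
split=> /=.
- by move=> l; exact: tpi.
- by move=> v; rewrite hid.
- by move=> v w vw; rewrite !hid; apply: t1o => /hvI.
- move=> l m e; have e' : src (h l) = rng (h m) by rewrite hs hr e.
  by rewrite (hc _ _ e e'); exact: t2.
- by move=> l m e; apply: t20; rewrite hs hr => /hvI.
- by move=> l; rewrite t3 hs hid.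
- move=> v n; have [m hm] := hp v n.
  by rewrite hid (t4 _ m) hm fsbig_image// => x y _ _; exact: hI.
Qed.

(** Both maps mediate the cocone [f \o psi k], so uniqueness applies. *)
Lemma inductive_limit_ext (D : nat -> cstarAlgType R)
    (iota : forall i j : nat, (i <= j)%N -> D i -> D j)
    A B (psi : forall k, D k -> A) (f g : A -> B) :
  is_inductive_limit iota psi -> star_hom f -> star_hom g ->
  (forall k a, f (psi k a) = g (psi k a)) -> f =1 g.
Proof.
move=> [_ [psi_hom psi_iota] univ] hf hg fg.
have fcocone : cocone iota (fun k => f \o psi k).
  by split=> [k|i j h a /=]; [exact: star_hom_comp | rewrite psi_iota].
have [k [_ kuniq]] := univ _ _ fcocone.
have fE : k = f by apply: kuniq.
have gE : k = g by apply: kuniq; split=> // i a /=; rewrite fg.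
by move=> x; rewrite -fE gE.
Qed.

(** * Continuity of the C*-operations *)

Lemma norm_star A (x : A) : `|star x| = `|x|.
Proof.
have le (y : A) : `|y| <= `|star y|.
  have [->|y0] := eqVneq `|y| 0; first exact: normr_ge0.
  have yp : 0 < `|y| by rewrite lt0r y0 normr_ge0.
  by rewrite -(ler_pM2r yp) -expr2 -cstar_identity normr_cmul.
by apply/le_anti; rewrite le andbT -{2}(starK x) le.
Qed.

Lemma starB A (x y : A) : star (x - y) = star x - star y.
Proof.
have := star_conj_lin (-1) y x; rewrite scaleN1r addrC => ->.
by rewrite rmorphN rmorph1 scaleN1r addrC.
Qed.

Lemma cmulBl A (x y z : A) : (x - y) ** z = x ** z - y ** z.
Proof.
by have := cmul_linl (-1) y x z; rewrite !scaleN1r addrC => ->; rewrite addrC.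
Qed.

Lemma cmulBr A (x y z : A) : z ** (x - y) = z ** x - z ** y.
Proof.
by have := cmul_linr (-1) y x z; rewrite !scaleN1r addrC => ->; rewrite addrC.
Qed.

Lemma star_continuous A : continuous (@star R A).
Proof.
apply: (@lipschitz_normed_continuous _ _ _ 1) => // x y.
by rewrite mul1r -starB norm_star.
Qed.

Lemma cmul_continuousl A (z : A) : continuous (fun x : A => x ** z).
Proof.
apply: (@lipschitz_normed_continuous _ _ _ `|z|) => // x y.
by rewrite -cmulBl mulrC normr_cmul.
Qed.

Lemma cmul_continuousr A (z : A) : continuous (fun x : A => z ** x).
Proof.
apply: (@lipschitz_normed_continuous _ _ _ `|z|) => // x y.
by rewrite -cmulBr normr_cmul.
Qed.

End StarHomTheory.

(** Binary operations pass to the closure one argument at a time, so separate continuity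
    suffices. *)
Lemma closed_star_subalgebra_closure (R : realType) (A : cstarAlgType R)
    (S : set A) :
  S 0 -> (forall (a : R[i]) (x y : A), S x -> S y -> S (a *: x + y)) ->
  (forall x y : A, S x -> S y -> S (x ** y)) ->
  (forall x : A, S x -> S (star x)) ->
  closed_star_subalgebra (closure S).
Proof.
move=> S0 SL SM SS; split.
- exact: closed_closure.
- exact: subset_closure.
- move=> a x y Sx Sy.
  apply: (@closure_continuous _ _ (fun x => a *: x + y) S S) Sx => [z|x' Sx'].
    by apply: cvgD; [apply: cvgZr; exact: cvg_id | exact: cvg_cst].
  apply: (@closure_continuous _ _ (fun y => a *: x' + y) S S) Sy => [z|y' Sy'].
    by apply: cvgD; [exact: cvg_cst | exact: cvg_id].
  by apply: subset_closure; exact: SL.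
- move=> x y Sx Sy.
  apply: (@closure_continuous _ _ (fun x => x ** y) S S) Sx => [|x' Sx'].
    exact: cmul_continuousl.
  apply: (@closure_continuous _ _ (fun y => x' ** y) S S) Sy => [|y' Sy'].
    exact: cmul_continuousr.
  by apply: subset_closure; exact: SM.
- move=> x; apply: closure_continuous => [|y Sy]; first exact: star_continuous.
  by apply: subset_closure; exact: SS.
Qed.

(** * Paths of the truncations *)

Section TruncTheory.
Variable L : Ngraph.

Lemma trunc_incl_inj k : injective (@trunc_incl L k).
Proof. exact: val_inj. Qed.

Lemma trunc_widen_inj i k (h : (i <= k)%N) : injective (@trunc_widen L i k h).
Proof. by move=> x y /(congr1 val) /= /val_inj. Qed.

Lemma trunc_paths_fromP k (v : vertex L) n (l : gpath (trunc L k)) :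
  @paths_from _ (trunc L k) v n l <-> @paths_from _ L v (pad n) (trunc_incl l).
Proof.
case: l => l hl; split=> -[rl dl]; split=> //; exact/(deg_padP _ hl).
Qed.

(** A path of degree [pad n] has zero entries from index [k] on, so it already lies in the
    truncation. *)
Lemma paths_from_trunc_incl k (v : vertex L) n :
  paths_from v (pad n) =
  @trunc_incl L k @` @paths_from _ (trunc L k) v n.
Proof.
apply/seteqP; split=> [l [rl dl]|_ [l /trunc_paths_fromP ln <-]//].
have hl : in_trunc k l by apply/asboolP => i ki; rewrite dl pad_out.
by exists (exist _ l hl) => //; apply/trunc_paths_fromP.
Qed.

(** The degree on the left is [n] extended by zeros to [k] coordinates; both have the same padding,
    so both sides are the same paths of [L]. *)
Lemma paths_from_trunc_widen i k (h : (i <= k)%N) (v : vertex L) n :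
  @paths_from _ (trunc L k) v [ffun x : 'I_k => @pad i n x] =
  @trunc_widen L i k h @` @paths_from _ (trunc L i) v n.
Proof.
have padE' : pad [ffun x : 'I_k => @pad i n x] = pad n.
  apply/fsfunP => x; have [kx|xk] := leqP k x.
    by rewrite !pad_out // (leq_trans h).
  by rewrite pad_in ffunE.
apply/seteqP; split=> [l|_ [l ln <-]].
  move=> /trunc_paths_fromP; rewrite padE' paths_from_trunc_incl => -[m mn ml].
  by exists m => //; apply: trunc_incl_inj.
by apply/trunc_paths_fromP; rewrite padE'; apply/trunc_paths_fromP.
Qed.

Lemma row_finite_trunc k : row_finite L -> row_finite (trunc L k).
Proof.
move=> rL v n; have := rL v (pad n); rewrite paths_from_trunc_incl => fin.
apply: sub_finite_set (finite_preimage _ fin); first exact: preimage_image.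
by move=> x y _ _; exact: trunc_incl_inj.
Qed.

Lemma finNseq_eventually0 (m : finNseq) :
  exists k, forall i, (k <= i)%N -> m i = 0%N.
Proof.
(* The bound lies strictly above every index of the support. *)
exists (\max_(i <- finsupp m) i.+1)%N => i ki; apply: fsfun_dflt.
apply/negP => im; have : (i < i)%N; last by rewrite ltnn.
apply: leq_trans ki; exact: (@leq_bigmax_seq _ _ xpredT (fun j => j.+1) i).
Qed.

Lemma in_trunc_level (l : gpath L) : exists k, in_trunc k.+1 l.
Proof.
have [k hk] := finNseq_eventually0 (deg l).
by exists k; apply/asboolP => i /ltnW; exact: hk.
Qed.

(** * Restricting and gluing Cuntz-Krieger families *)

Variables (R : realType) (A : cstarAlgType R).

Lemma ck_family_trunc_incl k (t : gpath L -> A) :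
  ck_family t -> ck_family (t \o @trunc_incl L k).
Proof.
apply: (@ck_family_pullback _ _ _ (trunc L k) L id) => //.
- exact: trunc_incl_inj.
(* The two composites differ only in their proofs of composability. *)
- by move=> l m e e'; congr gcomp; exact: Prop_irrelevance.
- by move=> v n; exists (pad n); exact: paths_from_trunc_incl.
Qed.

Lemma ck_family_trunc_widen i k (h : (i <= k)%N) (t : gpath (trunc L k) -> A) :
  ck_family t -> ck_family (t \o @trunc_widen L i k h).
Proof.
apply: (@ck_family_pullback _ _ _ (trunc L i) (trunc L k) id) => //.
- exact: trunc_widen_inj.
- by move=> v; exact: val_inj.
- by move=> l m e e'; apply: val_inj; congr gcomp; exact: Prop_irrelevance.
- move=> v n; exists [ffun x : 'I_k => @pad i n x].
  exact: paths_from_trunc_widen.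
Qed.

(* Each Cuntz-Krieger relation involves at most two paths or one degree, hence
   lives in a single truncation. *)
Lemma ck_family_glue (u : gpath L -> A) :
  (forall k, ck_family (u \o @trunc_incl L k.+1)) -> ck_family u.
Proof.
move=> uck.
have lift2 (l m : gpath L) : exists k (l' m' : gpath (trunc L k.+1)),
    l = trunc_incl l' /\ m = trunc_incl m'.
  have [i hi] := in_trunc_level l; have [j hj] := in_trunc_level m.
  have hl : in_trunc (maxn i j).+1 l.
    by apply: in_trunc_le hi; rewrite ltnS leq_maxl.
  have hm : in_trunc (maxn i j).+1 m.
    by apply: in_trunc_le hj; rewrite ltnS leq_maxr.
  by exists (maxn i j), (exist _ l hl), (exist _ m hm).
split.
- move=> l; have [k [l' [_ [-> _]]]] := lift2 l l.
  exact: (ck_partial_isometry (uck k) l').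
(* Identity paths lie in every truncation, so the first one serves. *)
- move=> v; exact: (ck1_proj (uck 0%N) v).
- move=> v w vw; exact: (ck1_orth (uck 0%N) vw).
- move=> l m e; have [k [l' [m' [lE mE]]]] := lift2 l m; subst l m.
  rewrite (ck2 (uck k) (l := l') (m := m') e) /=.
  by congr (u (gcomp _)); exact: Prop_irrelevance.
- move=> l m; have [k [l' [m' [-> ->]]]] := lift2 l m => e.
  exact: (ck2_0 (uck k) (l := l') (m := m') e).
- move=> l; have [k [l' [_ [-> _]]]] := lift2 l l.
  exact: (ck3 (uck k) l').
(* Beyond the support of [n], truncation contains every path of degree [n], so the whole sum in
   (CK4) is taken there. *)
- move=> v n; have [k hk] := finNseq_eventually0 n.
  pose n' := [ffun i : 'I_k.+1 => n i].
  have nE : n = pad n'.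
    apply/fsfunP => i; have [ki|ik] := leqP k.+1 i.
      by rewrite pad_out// hk// ltnW.
    by rewrite pad_in ffunE.
  rewrite nE paths_from_trunc_incl fsbig_image; last first.
    by move=> x y _ _; exact: trunc_incl_inj.
  exact: (ck4 (uck k) v n').
Qed.

End TruncTheory.

(* The system is indexed from k = 1: [A k] is the C*-algebra of the
   [k.+1]-graph [trunc L k.+1]. *)
Theorem theorem2p8 (R : realType) (L : Ngraph)
    (L_row_finite : row_finite L) (L_no_sources : no_sources L)
    (A : nat -> cstarAlgType R)
    (s : forall k : nat, gpath (trunc L k.+1) -> A k)
    (A_univ : forall k : nat, is_graph_cstar_algebra (s k))
    (CL : cstarAlgType R) (t : gpath L -> CL)
    (CL_univ : is_graph_cstar_algebra t) :
  exists (iota : forall i j : nat, (i <= j)%N -> A i -> A j)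
         (phi : forall k : nat, A k -> CL),
    [/\ (forall (i j : nat) (h : (i <= j)%N) (l : gpath (trunc L i.+1)),
           iota i j h (s i l) =
           s j (@trunc_widen L i.+1 j.+1 h l)),
        (forall (k : nat) (l : gpath (trunc L k.+1)),
           phi k (s k l) = t (trunc_incl l)),
        is_inductive_limit iota phi,
        closure (\bigcup_k range (phi k)) = [set: CL] &
        forall (M : cstarAlgType R) (psi : forall k : nat, A k -> M),
          is_inductive_limit iota psi ->
          exists Phi : M -> CL,
            [/\ star_hom Phi, bijective Phi &
                forall (k : nat) (l : gpath (trunc L k.+1)),
                  Phi (psi k (s k l)) = t (trunc_incl l)]].
Proof.
have rT k : row_finite (trunc L k.+1) by exact: row_finite_trunc.
(* The connecting maps come from the universal property of [A i], applied to the family of [A j]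
   restricted to the smaller graph. *)
have /(_ _ _ _)/cid iotaP i j (h : (i <= j)%N) : exists f : A i -> A j,
    star_hom f /\ forall l, f (s i l) = s j (@trunc_widen L i.+1 j.+1 h l).
  have ckj :=
    @ck_family_trunc_widen _ _ _ i.+1 j.+1 h _ (graph_cstar_ck (A_univ j)).
  by have [f [fP _]] := graph_cstar_universal (A_univ i) ckj; exists f.
pose iota i j h : A i -> A j := sval (iotaP i j h).
have iota_hom i j h : star_hom (iota i j h) by case: (svalP (iotaP i j h)).
have iotaE i j h l : iota i j h (s i l) = s j (@trunc_widen L i.+1 j.+1 h l).
  by case: (svalP (iotaP i j h)) => _; apply.
have /(_ _)/cid phiP k : exists f : A k -> CL,
    star_hom f /\ forall l, f (s k l) = t (trunc_incl l).
  have ckk := ck_family_trunc_incl k.+1 (graph_cstar_ck CL_univ).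
  by have [f [fP _]] := graph_cstar_universal (A_univ k) ckk; exists f.
pose phi k : A k -> CL := sval (phiP k).
have phi_hom k : star_hom (phi k) by case: (svalP (phiP k)).
have phiE k l : phi k (s k l) = t (trunc_incl l).
  by case: (svalP (phiP k)) => _; apply.
(* From here on only the homomorphism property and the values on generators matter. *)
clearbody iota phi.
have isys : inductive_system iota.
  split=> [i j h|i h|i j k hij hjk hik]; first exact: iota_hom.
    apply: (graph_cstar_ext (rT i) (A_univ i)) => // l.
    by rewrite iotaE; congr (s i _); exact: val_inj.
  apply: (graph_cstar_ext (rT i) (A_univ i) (star_hom_comp _ _)) => // l /=.
  by rewrite !iotaE; congr (s k _); exact: val_inj.
have phi_cocone : cocone iota phi.
  split=> [k|i j h]; first exact: phi_hom.
  have hom := star_hom_comp (iota_hom i j h) (phi_hom j).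
  apply: (graph_cstar_ext (rT i) (A_univ i) hom) => // l /=.
  by rewrite iotaE !phiE.
pose level (l : gpath L) := cid (in_trunc_level l).
pose lift l : gpath (trunc L (sval (level l)).+1) :=
  exist _ l (svalP (level l)).
have ilim : is_inductive_limit iota phi.
  split=> // B theta [theta_hom theta_iota].
  (* Each path is evaluated at a chosen level; [uE] shows independence of the choice by moving both
     levels to their maximum. *)
  pose u l := theta _ (s _ (lift l)).
  have uE k (l : gpath (trunc L k.+1)) : u (trunc_incl l) = theta k (s k l).
    rewrite /u; set l' := lift _; set k' := sval _ in l' *.
    rewrite -(theta_iota _ _ (leq_maxl k' k)) -(theta_iota _ _ (leq_maxr k' k)).
    by rewrite !iotaE; congr (theta _ (s _ _)); exact: val_inj.
  have uck : ck_family u.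
    apply: ck_family_glue => k.
    rewrite (_ : u \o _ = theta k \o s k); last by apply/funext => l /=.
    exact: ck_family_star_hom (graph_cstar_ck (A_univ k)).
  have [f [[fhom ft] funiq]] := graph_cstar_universal CL_univ uck.
  exists f; split=> [|g [ghom gphi]].
    split=> // k.
    apply: (graph_cstar_ext (rT k) (A_univ k) (star_hom_comp _ _)) => // l /=.
    by rewrite phiE ft uE.
  (* Every path is the inclusion of its lift, so the cocone fixes [g] on all generators. *)
  by apply: funiq; split=> // l; rewrite -[l]/(trunc_incl (lift l)) -phiE gphi.
exists iota, phi; split=> //.
(* The closure contains every generator; it remains to see that it is a closed star-subalgebra. *)
- apply: (graph_cstar_generated CL_univ); last first.
    move=> _ [l _ <-]; apply: subset_closure.
    by exists (sval (level l)) => //; exists (s _ (lift l)); rewrite ?phiE.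
  (* The union is directed: two elements always come from a common level. *)
  have bigU2 x y : (\bigcup_k range (phi k)) x -> (\bigcup_k range (phi k)) y ->
      exists k a b, x = phi k a /\ y = phi k b.
    move=> [i _ [a _ <-]] [j _ [b _ <-]].
    exists (maxn i j), (iota _ _ (leq_maxl i j) a), (iota _ _ (leq_maxr i j) b).
    by rewrite !(cocone_comp phi_cocone).
  apply: closed_star_subalgebra_closure.
  + by exists 0%N => //; exists 0 => //; exact: star_hom0.
  + move=> a x y xU yU; have [k [b [c [-> ->]]]] := bigU2 _ _ xU yU.
    by exists k => //; exists (a *: b + c) => //;
      rewrite (star_hom_linear (phi_hom k)).
  + move=> x y xU yU; have [k [b [c [-> ->]]]] := bigU2 _ _ xU yU.
    by exists k => //; exists (b ** c) => //; rewrite (star_homM (phi_hom k)).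
  + move=> _ [k _ [a _ <-]].
    by exists k => //; exists (star a) => //;
      rewrite (star_hom_star (phi_hom k)).
(* The mediating maps between the two limits compose to maps fixing each cocone, hence to
   identities. *)
- move=> M psi Mlim.
  have [F [[Fhom Fpsi] _]] := indlim_universal Mlim phi_cocone.
  have [G [[Ghom Gphi] _]] := indlim_universal ilim (indlim_cocone Mlim).
  exists F; split=> // [|k l]; last by rewrite Fpsi phiE.
  exists G.
    apply: (inductive_limit_ext Mlim (star_hom_comp Fhom Ghom)) => // k a /=.
    by rewrite Fpsi Gphi.
  apply: (inductive_limit_ext ilim (star_hom_comp Ghom Fhom)) => // k a /=.
  by rewrite Gphi Fpsi.
Qed.
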